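(* Let $p$ be an odd prime and $e$ a positive integer with $e\equiv2\pmod4$ and $p\mid e$; put $q=p^e$. For $i\in\{0,1\}$ let $D_i=\{x\in\mathbb{F}_q:\mathrm{Tr}(x^{p+1}-x)\in C_i^{(2,p)}\}$ and $\mathcal{C}_{D_i}=\{(\mathrm{Tr}(ax))_{x\in D_i}:a\in\mathbb{F}_q\}$. Then $\mathcal{C}_{D_i}$ has length $\frac{p-1}{2}p^{e-1}+\frac{p-1}{2}p^{\frac e2-1}$ and dimension $e$, it has at most $4$ nonzero weights, and its weight distribution is (weight: number of codewords), with $W=\frac{(p-1)^2}{2}p^{e-2}$: - $0$: $1$; - $W$: $\frac{p+1}{2}p^{e-2}-1-\frac{p-1}{2}p^{\frac e2-1}$; - $W+\frac{p-1}{2}p^{\frac e2-1}$: $\frac{p^2-1}{2}p^{e-2}$; - $W+(p-1)p^{\frac e2-1}$: $\frac{p-1}{2}p^{e-2}+\frac{p-1}{2}p^{\frac e2-1}$; - $W+\frac{p-3}{2}p^{\frac e2-1}$: $\frac{(p-1)^2}{2}p^{e-2}$.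
   Context: $\mathrm{Tr}$ is the absolute trace $\mathbb{F}_q\to\mathbb{F}_p$. $C_0^{(2,p)}$ (resp. $C_1^{(2,p)}$) is the set of squares (resp. non-squares) in $\mathbb{F}_p^*$. Weights are Hamming weights. *)

(* Defs.v *)
From mathcomp Require Import all_boot all_order all_algebra.
Set Implicit Arguments. Unset Strict Implicit. Unset Printing Implicit Defensive.
Import GRing.Theory.
Local Open Scope ring_scope.

Section Defs.
Variables (F : finFieldType) (p e : nat).

(* absolute trace F_{p^e} -> F_p, values taken in the prime subfield of F *)
Definition Tr (x : F) : F := \sum_(i < e) x ^+ (p ^ i).

Definition primeField : {set F} := [set (k%:R : F) | k : 'I_p].

Definition C0 : {set F} :=
  [set y in primeField | (y != 0) && [exists z in primeField, z ^+ 2 == y]].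
Definition C1 : {set F} :=
  [set y in primeField | (y != 0) && ~~ [exists z in primeField, z ^+ 2 == y]].

Definition Cc (i : bool) : {set F} := if i then C1 else C0.

Definition Dset (i : bool) : {set F} := [set x | Tr (x ^+ p.+1 - x) \in Cc i].

(* codeword (Tr(a x))_{x in D}, encoded as a function on F vanishing off D *)
Definition codeword (D : {set F}) (a : F) : {ffun F -> F} :=
  [ffun x => if x \in D then Tr (a * x) else 0].

Definition Dcode (D : {set F}) : {set {ffun F -> F}} := [set codeword D a | a : F].

End Defs.

Local Close Scope ring_scope.

Definition wt (F : finFieldType) (c : {ffun F -> F}) : nat := #|[set x | c x != 0%R]|.

Definition Acount (F : finFieldType) (C : {set {ffun F -> F}}) (w : nat) : nat :=
  #|[set c in C | wt c == w]|.

(* dimension over F_p of an F_p-linear code with #|C| = p^k codewords *)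
Definition codeDim (F : finFieldType) (p : nat) (C : {set {ffun F -> F}}) : nat :=
  logn p #|C|.

Definition wdist (p e : nat) : seq (nat * nat) :=
  let h := (p - 1)./2 in
  let W := ((p - 1) ^ 2)./2 * p ^ (e - 2) in
  let s := p ^ (e./2 - 1) in
  [:: (0%N, 1%N);
      (W, (p + 1)./2 * p ^ (e - 2) - 1 - h * s);
      (W + h * s, ((p ^ 2 - 1)./2) * p ^ (e - 2));
      (W + (p - 1) * s, h * p ^ (e - 2) + h * s);
      (W + ((p - 3)./2) * s, ((p - 1) ^ 2)./2 * p ^ (e - 2))]%N.

Definition nzWeights (F : finFieldType) (C : {set {ffun F -> F}}) : seq nat :=
  undup [seq wt c | c <- enum C & c != 0%R].

(* Main.v *)
Require Import Defs.
From mathcomp Require Import all_boot all_order all_algebra all_field.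
From mathcomp Require Import zify ring.
Set Implicit Arguments. Unset Strict Implicit. Unset Printing Implicit Defensive.
Import GRing.Theory Num.Theory.

(** Write m = e/2, which is odd, Q x = Tr (x^(p+1)) and B for its polar form.
    Because p | e, one has Tr (x^(p+1) - x) = Q (x - 1/2), so the code is
    governed by the joint distribution of Q y and B b y.

    The form B is nondegenerate and Q (l x) = l^(p+1) Q x for l in F_(p^2).
    Hence Q takes all nonzero values equally often.  The substitution
    (x, y) = (u + v, u - v) computes the number of pairs with Q x = Q y, which
    leaves two candidates for the number of zeros of Q, and only one of them
    is 1 modulo p^2 - 1.

    Counting the pairs (y, w) with Q y + w (B b y - s) = c in two ways then
    gives #{y : Q y = c, B b y = s}.  The weight of the codeword attached to b
    is W + K p^(m-1), where K is the number of w in F_p such that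
    w Tr b - w^2 Q b lies in C_i. *)

(** * Arithmetic of the constants in the weight table *)

Section OddHalves.
Variable h : nat.
Let p := h.*2.+1.

Lemma halfB1 : (p - 1)./2 = h. Proof. by rewrite subn1 doubleK. Qed.
Lemma halfD1 : (p + 1)./2 = h.+1. Proof. by rewrite addn1 -doubleS doubleK. Qed.
Lemma halfB3 : (p - 3)./2 = h - 1.
Proof. by rewrite /p subSS -(doubleB _ 1) doubleK. Qed.
Lemma half_predn_sqr : ((p - 1) ^ 2)./2 = h * p.-1.
Proof. by rewrite subn1 /= -[RHS]doubleK doubleMl mulnn. Qed.
Lemma half_sqr_predn : (p ^ 2 - 1)./2 = h * p.+1.
Proof. by rewrite (subn_sqr p 1) -[RHS]doubleK doubleMl subn1 addn1. Qed.
End OddHalves.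

(** The marginals and the total determine a 2 by 2 table: the first letter records whether Tr b = 0,
    the second whether - Q b lies in the chosen class, with P = p^(e-2) and s = p^(m-1). The
    predecessor in [tf.-1] leaves out b = 0. *)
Lemma freq_solve (h P s tt tf ft ff : nat) (p := h.*2.+1) :
  tt = h * (P + s) -> tf + tt = p * P -> ft + tt = h * (p * P + s) ->
  tt + tf + (ft + ff) = p * (p * P) ->
  [/\ tf.-1 = h.+1 * P - 1 - h * s, ft = h * p.-1 * P & ff = h * p.+1 * P].
Proof.
rewrite /p /= -mul2n => -> E1 E2 E3; clear p.
have FT : ft = h * (2 * h) * P by nia.
have TF : tf + h * s = h.+1 * P by nia.
split=> //; first by rewrite -TF; clear; lia.
by subst ft; nia.
Qed.

Local Open Scope ring_scope.

Lemma sum_card_fibre (S T : finType) (f : S -> T) (A : {set T}) :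
  (forall x, f x \in A) -> (\sum_(t in A) #|[set x | f x == t]| = #|S|)%N.
Proof.
move=> fA; rewrite -[RHS]sum1_card [RHS](partition_big f (mem A)) /=; last by move=> x _; exact: fA.
by apply: eq_bigr => t _; rewrite sum1dep_card.
Qed.

(** * The prime subfield and the absolute trace *)

Section TraceForm.

Variables (F : finFieldType) (p e : nat).
Hypotheses (p_pr : prime p) (charF : p \in [pchar F]) (cardF : #|F| = (p ^ e)%N).

Local Notation Tr := (@Tr F p e).
Local Notation Fp := (primeField F p).

Lemma frobD k (x y : F) : (x + y) ^+ (p ^ k) = x ^+ (p ^ k) + y ^+ (p ^ k).
Proof. by apply: exprDn_pchar; rewrite pnatX pnatE // charF. Qed.

Lemma frob_sum k (I : Type) (r : seq I) (P : pred I) (G : I -> F) :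
  (\sum_(i <- r | P i) G i) ^+ (p ^ k) = \sum_(i <- r | P i) G i ^+ (p ^ k).
Proof.
apply: (big_morph (fun x : F => x ^+ (p ^ k)) (@frobD k)).
by rewrite expr0n gtn_eqF // expn_gt0 prime_gt0.
Qed.

Lemma frob_card (x : F) : x ^+ (p ^ e) = x.
Proof. by rewrite -cardF expf_card. Qed.

Lemma natr_inj_lt (a b : nat) : (a < p)%N -> (b < p)%N -> a%:R = b%:R :> F -> a = b.
Proof.
clear cardF; wlog le_ab : a b / (a <= b)%N => [wl|] pa pb eqab.
  by case/orP: (leq_total a b) => ?; [apply: wl | apply/esym/wl].
have : (b - a)%:R == 0 :> F by rewrite natrB // eqab subrr.
rewrite -(dvdn_pcharf charF) => /dvdnP [[|k] ?]; first lia.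
by exfalso; nia.
Qed.

Lemma card_primeField : #|Fp| = p.
Proof.
rewrite card_imset ?card_ord // => a b /= /natr_inj_lt eqab.
by apply/val_inj/eqab.
Qed.

(** The p elements of the prime subfield are roots of X^p - X, and this polynomial has no more than
    p roots. *)
Lemma primeFieldE (x : F) : (x \in Fp) = (x ^+ p == x).
Proof.
suff -> : Fp = [set x | x ^+ p == x] by rewrite inE.
apply/eqP; rewrite eqEcard card_primeField; apply/andP; split.
  apply/subsetP => _ /imsetP[k _ ->]; rewrite inE.
  by apply/eqP; exact: (pFrobenius_aut_nat charF).
have szP : size ('X^p - 'X : {poly F}) = p.+1.
  by rewrite size_polyDl size_polyXn // size_polyN size_polyX ltnS prime_gt1.
rewrite -ltnS -szP cardE; apply: max_poly_roots (enum_uniq _).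
  by rewrite -size_poly_eq0 szP.
apply/allP => y; rewrite mem_enum inE => /eqP yp.
by rewrite rootE !hornerE yp subrr.
Qed.

Lemma Fp_exp (x : F) : x \in Fp -> x ^+ p = x.
Proof. by rewrite primeFieldE => /eqP. Qed.

Lemma Fp_expX k (x : F) : x \in Fp -> x ^+ (p ^ k) = x.
Proof.
move=> xFp; elim: k => [|k IH]; first by rewrite expr1.
by rewrite expnS exprM Fp_exp.
Qed.

Lemma Fp_nat k : k%:R \in Fp.
Proof. by rewrite primeFieldE; apply/eqP; exact: (pFrobenius_aut_nat charF). Qed.

Lemma FpD (x y : F) : x \in Fp -> y \in Fp -> x + y \in Fp.
Proof.
move=> /Fp_exp xp /Fp_exp yp; rewrite primeFieldE.
by have := frobD 1 x y; rewrite !expn1 xp yp => ->.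
Qed.

Lemma FpM (x y : F) : x \in Fp -> y \in Fp -> x * y \in Fp.
Proof. by move=> /Fp_exp xp /Fp_exp yp; rewrite primeFieldE exprMn xp yp. Qed.

Lemma FpN (x : F) : x \in Fp -> - x \in Fp.
Proof.
move=> xF; rewrite primeFieldE; apply/eqP.
by rewrite -[LHS]/(pFrobenius_aut charF (- x)) pFrobenius_autN pFrobenius_autE Fp_exp.
Qed.

Lemma FpV (x : F) : x \in Fp -> x^-1 \in Fp.
Proof. by move=> /Fp_exp xp; rewrite primeFieldE exprVn xp. Qed.

Lemma Fp0 : 0 \in Fp. Proof. exact: (Fp_nat 0). Qed.
Lemma Fp1 : 1 \in Fp. Proof. exact: (Fp_nat 1). Qed.

Lemma TrD (x y : F) : Tr (x + y) = Tr x + Tr y.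
Proof. by rewrite /Defs.Tr -big_split; apply: eq_bigr => i _; rewrite /= frobD. Qed.

Lemma TrZ (c x : F) : c \in Fp -> Tr (c * x) = c * Tr x.
Proof.
by move=> cF; rewrite /Defs.Tr mulr_sumr; apply: eq_bigr => i _; rewrite exprMn (Fp_expX _ cF).
Qed.

Lemma TrN (x : F) : Tr (- x) = - Tr x.
Proof. by rewrite -mulN1r TrZ ?mulN1r // FpN // Fp1. Qed.

Lemma TrB (x y : F) : Tr (x - y) = Tr x - Tr y.
Proof. by rewrite TrD TrN. Qed.

Lemma Tr0 : Tr 0 = 0.
Proof. by have := TrB 0 0; rewrite !subrr. Qed.

(** Frobenius permutes the summands of the trace cyclically, because x^(p^e) = x. *)
Lemma Tr_frob (x : F) : Tr (x ^+ p) = Tr x.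
Proof.
rewrite /Defs.Tr; case: (posnP e) => [->|e0]; first by rewrite !big_ord0.
have := frob_card x; case: e e0 => // e' _ xq.
rewrite big_ord_recr big_ord_recl /= addrC expn0 expr1 -exprM -expnS xq; congr (_ + _).
by apply: eq_bigr => i _; rewrite -exprM -expnS.
Qed.

Lemma Tr_Fp (x : F) : Tr x \in Fp.
Proof.
rewrite primeFieldE -{2}Tr_frob /Defs.Tr -[X in _ ^+ X]expn1 frob_sum; apply/eqP.
by apply: eq_bigr => i _; rewrite -!exprM mulnC expn1.
Qed.

Hypothesis e_gt0 : (0 < e)%N.

(* A fibre has at most p^(e-1) points since Tr is a polynomial of that degree,
   and the p fibres exhaust F. *)
Lemma card_Tr_fibre (s : F) : s \in Fp -> #|[set x | Tr x == s]| = (p ^ e.-1)%N.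
Proof.
have p1 := prime_gt1 p_pr.
have ub t : (#|[set x | Tr x == t]| <= p ^ e.-1)%N.
  pose P : {poly F} := (\sum_(i < e) 'X^(p ^ i)) - t%:P.
  (* This coefficient shows that [P] is not zero; as p^(e-1) > 0, the constant [t] does not reach
     it. *)
  have Pcoef : P`_(p ^ e.-1) = 1.
    rewrite coefB coefC gtn_eqF ?expn_gt0 ?prime_gt0 // subr0 coef_sum.
    case: e e_gt0 => // e' _ /=.
    rewrite big_ord_recr /= coefXn eqxx big1 ?add0r // => i _.
    by rewrite coefXn eqn_exp2l // gtn_eqF.
  have P0 : P != 0 by apply: contra_eq_neq Pcoef => ->; rewrite coef0 eq_sym oner_neq0.
  have szP : (size P <= (p ^ e.-1).+1)%N.
    rewrite (leq_trans (size_polyD _ _)) // geq_max size_polyN.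
    rewrite (leq_trans (size_polyC_leq1 _)) // andbT.
    apply: (leq_trans (size_sum _ _ _)); apply/bigmax_leqP => i _.
    rewrite size_polyXn ltnS leq_exp2l //; have := ltn_ord i; lia.
  rewrite -ltnS (leq_trans _ szP) // cardE; apply: max_poly_roots (enum_uniq _) => //.
  apply/allP => y; rewrite mem_enum inE => /eqP yt.
  rewrite rootE hornerD hornerN hornerC horner_sum.
  have -> : \sum_(i < e) ('X^(p ^ i)).[y] = Tr y.
    by apply: eq_bigr => i _; rewrite hornerXn.
  by rewrite yt subrr.
have sumE : (\sum_(t in Fp) #|[set x | Tr x == t]| = \sum_(t in Fp) p ^ e.-1)%N.
  rewrite sum_nat_const card_primeField -expnS prednK // -cardF.
  by apply: sum_card_fibre => x; exact: Tr_Fp.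
(* Termwise upper bounds whose sums agree are all equalities. *)
have /leqif_sum[_] : forall t, t \in Fp ->
    (#|[set x | Tr x == t]| <= p ^ e.-1 ?= iff (#|[set x | Tr x == t]| == p ^ e.-1))%N.
  by move=> t _; split.
by rewrite sumE eqxx => /esym/forall_inP + sF => /(_ s sF)/eqP.
Qed.

Lemma card_Trmul_fibre (a s : F) : a != 0 -> s \in Fp ->
  #|[set x | Tr (a * x) == s]| = (p ^ e.-1)%N.
Proof.
move=> a0 sF; rewrite -(card_Tr_fibre sF) -[RHS](card_imset _ (mulfI (invr_neq0 a0))).
apply: eq_card => x; rewrite inE; apply/idP/imsetP => [xs|[y + ->]].
  by exists (a * x); rewrite ?inE ?mulKf.
by rewrite inE mulVKf.
Qed.

End TraceForm.

(** * Arithmetic that determines the number of zeros of Q *)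

Lemma even_expn_mod p k : ~~ odd k -> (0 < p)%N -> (p ^ 2 - 1 %| p ^ k - 1)%N.
Proof.
move=> kev p0; rewrite -[k]odd_double_half (negPf kev) add0n -mul2n expnM -(exp1n k./2).
by rewrite subn_exp exp1n dvdn_mulr.
Qed.

(** Here [n0] and [n] stand for the numbers of points where Q is 0 and where Q is 1, and s =
    p^(m-1). Eliminating [n0] from the first and second moments gives (p s^2 - n)^2 = s^2, so n = p
    s^2 + s or n = p s^2 - s; the congruences modulo p^2 - 1 exclude the second. *)
Lemma two_values_solve (p s n0 n : nat) : (2 < p)%N -> (0 < n0)%N -> (0 < s)%N ->
  (p ^ 2 - 1 %| s - 1)%N -> (p ^ 2 - 1 %| n0.-1)%N ->
  (n0 + p.-1 * n = p ^ 2 * s ^ 2)%N ->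
  (n0 ^ 2 + p.-1 * n ^ 2 = p ^ 2 * s ^ 2 + (p ^ 2 * s ^ 2 - 1) * (p * s ^ 2))%N ->
  (n = p * s ^ 2 + s)%N.
Proof.
move=> p2 n00 s0 /dvdnP[a aE] /dvdnP[b bE] E1 E2.
pose P : int := p; pose S : int := s; pose N0 : int := n0; pose N : int := n.
have sub1 k : (0 < k)%N -> (k - 1)%N%:Z = k%:Z - 1 by move=> k0; rewrite -subzn.
have pred1 : p.-1%:Z = P - 1 by rewrite -subn1 sub1 //; lia.
have sqZ k : (k ^ 2)%N%:Z = k%:Z ^+ 2 by rewrite expnS expn1 PoszM expr2.
have p20 : (0 < p ^ 2)%N by rewrite expn_gt0; lia.
have ps0 : (0 < p ^ 2 * s ^ 2)%N by rewrite muln_gt0 p20 expn_gt0 s0.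
have F1 : N0 = P ^+ 2 * S ^+ 2 - (P - 1) * N.
  by rewrite -!sqZ -pred1 -!PoszM -E1 PoszD addrK.
have F2 : N0 ^+ 2 + (P - 1) * N ^+ 2 = P ^+ 2 * S ^+ 2 + (P ^+ 2 * S ^+ 2 - 1) * (P * S ^+ 2).
  by rewrite -!sqZ -pred1 -!PoszM -sub1 // -!PoszM -!PoszD E2.
have P0 : P * (P - 1) != 0 by rewrite mulf_neq0 // /P; lia.
have : (P * (P - 1)) * ((P * S ^+ 2 - N) ^+ 2 - S ^+ 2) = 0.
  have : N0 ^+ 2 + (P - 1) * N ^+ 2 - (P ^+ 2 * S ^+ 2 + (P ^+ 2 * S ^+ 2 - 1) * (P * S ^+ 2)) = 0.
    by rewrite F2 subrr.
  by rewrite F1 => <-; ring.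
move/eqP; rewrite mulf_eq0 (negPf P0) /= subr_eq0 eqf_sqr => /orP[] /eqP D.
  (* The sign to be excluded: now n0 = p s^2 + (p-1) s, which is 2p - 1 modulo p^2 - 1. Being also
     1, it would force p + 1 to divide 2. *)
  have NE : N = P * S ^+ 2 - S 
    by have := congr1 (fun z => P * S ^+ 2 - z) D; rewrite subKr.
  pose T : int := a; pose K : int := b.
  have SE : S = 1 + (P ^+ 2 - 1) * T.
    by rewrite -sqZ -sub1 // -PoszM mulnC -aE sub1 // addrC subrK.
  have N0E : N0 = 1 + (P ^+ 2 - 1) * K.
    by rewrite -sqZ -sub1 // -PoszM mulnC -bE -subn1 sub1 // addrC subrK.
  exfalso.
  have : (P - 1) * (2 - (P + 1) * (K - P * T * (S + 1) - (P - 1) * T)) = 0.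
    transitivity (P * S ^+ 2 + (P - 1) * S - N0); last by rewrite F1 NE; ring.
    by rewrite N0E SE; ring.
  move/eqP; rewrite mulf_eq0 subr_eq0 [P == 1](_ : _ = false) /=; last by apply/eqP; rewrite /P; lia.
  rewrite subr_eq0 => /eqP; move: (K - _ - _) => c cE.
  have P3 : (3 <= P)%R by rewrite /P; lia.
  clearbody P; clear - cE P3.
  have [c0|c0] : c <= 0 \/ 1 <= c by lia.
    by have : (P + 1) * c <= 0 by [rewrite mulr_ge0_le0 //; lia]; lia.
  by have : (P + 1) * 1 <= (P + 1) * c by [rewrite ler_wpM2l //; lia]; lia.
have : N = P * S ^+ 2 + S
  by have := congr1 (fun z => P * S ^+ 2 - z) D; rewrite subKr opprK.
by rewrite -sqZ -PoszM -PoszD => -[].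
Qed.

(** * Roots of unity in a finite field *)

Section UnityRoots.

Variable F : finFieldType.

Lemma exists_prim_root : exists g : F, (#|F|.-1).-primitive_root g.
Proof.
have q1 := card_finNzRing_gt1 F.
have /hasP[g _ gP] : has (#|F|.-1).-primitive_root (enum (predC1 (0 : F))).
  apply: cyclic.has_prim_root (enum_uniq _) _; rewrite -?cardE ?cardC1 //; first by rewrite -subn1 subn_gt0.
  apply/allP => x; rewrite mem_enum inE => x0; rewrite unity_rootE.
  by rewrite -(inj_eq (mulfI x0)) -exprS prednK ?mulr1 ?expf_card // ltnW.
by exists g.
Qed.

Lemma card_unity_roots n : (n %| #|F|.-1)%N -> #|[set x : F | x ^+ n == 1]| = n.
Proof.
move=> nq; have [g gP] := exists_prim_root; have := dvdn_prim_root gP nq.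
move: (g ^+ _) => w wP; rewrite -{2}(card_ord n).
have inj : injective (fun i : 'I_n => w ^+ i).
  by move=> i j /eqP; rewrite (eq_prim_root_expr wP) !modn_small // => /eqP/val_inj.
rewrite -(card_imset _ inj); apply: eq_card => x; rewrite inE; apply/eqP/imsetP.
  by move=> /(prim_rootP wP)[i ->]; exists i.
by case=> i _ ->; rewrite exprAC (prim_expr_order wP) expr1n.
Qed.

(** Each nonempty fibre of x -> x^n on [S] is a coset of the group of n-th roots of unity, which has
    exactly n elements. *)
Lemma dvdn_card_stable n (S : {set F}) : (n %| #|F|.-1)%N -> 0 \notin S ->
  (forall l x, l ^+ n = 1 -> x \in S -> l * x \in S) -> (n %| #|S|)%N.
Proof.
move=> nq S0 stab; rewrite -sum1_card.
rewrite (partition_big (fun x : F => x ^+ n) predT) //=.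
apply: dvdn_sum => t _; rewrite sum1dep_card.
have [->|[x0]] := set_0Vmem [set x | (x \in S) && (x ^+ n == t)]; first by rewrite cards0.
rewrite inE => /andP[x0S /eqP x0t].
have x0N : x0 != 0 by apply: contraNneq S0 => <-.
rewrite -{1}(card_unity_roots nq) -(card_imset _ (mulIf x0N)).
rewrite [X in (_ %| X)%N](_ : _ = #|[set l * x0 | l in [set x | x ^+ n == 1]]|) ?dvdnn //.
apply: eq_card => x; rewrite inE; apply/idP/imsetP => [/andP[xS /eqP xt]|[l]].
  exists (x / x0); rewrite ?divfK // inE exprMn exprVn xt x0t divff //.
  by rewrite -x0t expf_neq0.
by rewrite inE => /eqP ln ->; rewrite stab //= exprMn ln x0t mul1r.
Qed.

End UnityRoots.

(** * The quadratic form Q, its polar form and nondegeneracy *)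

Section QuadraticForm.

Variables (F : finFieldType) (p m : nat).
Local Notation e := (m.*2).
Hypotheses (p_pr : prime p) (p_odd : odd p) (m_odd : odd m).
Hypotheses (charF : p \in [pchar F]) (cardF : #|F| = (p ^ e)%N).

Local Notation Tr := (@Tr F p e).
Local Notation Fp := (primeField F p).

Definition qform (x : F) : F := Tr (x ^+ p.+1).
Definition bform (x y : F) : F := Tr (x ^+ p * y + x * y ^+ p).
(** The linear map that represents the polar form under the trace pairing: x y^p is the p-th power
    of x^(p^(e-1)) y, so both have the same trace. *)
Definition adj (b : F) : F := b ^+ p + b ^+ (p ^ e.-1).

Local Notation TrD := (TrD e p_pr charF).
Local Notation TrZ := (TrZ e p_pr charF).
Local Notation TrB := (TrB e p_pr charF).
Local Notation Tr_frob := (Tr_frob cardF).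

Let m_gt0 : (0 < m)%N. Proof. by case: m m_odd. Qed.
Let e_gt0 : (0 < e)%N. Proof. by rewrite double_gt0. Qed.
Let p_gt2 : (2 < p)%N. Proof. by have := prime_gt1 p_pr; move: p_odd; case: p => [|[|[|]]]. Qed.
Let two_neq0 : 2%:R != 0 :> F.
Proof. by rewrite -(dvdn_pcharf charF) gtnNdvd. Qed.

Lemma frob1D (x y : F) : (x + y) ^+ p = x ^+ p + y ^+ p.
Proof. by have := frobD p_pr charF 1 x y; rewrite expn1. Qed.

Lemma qformD (x y : F) : qform (x + y) = qform x + bform x y + qform y.
Proof. by rewrite /qform /bform -!TrD !exprS frob1D; congr (Tr _); ring. Qed.

Lemma bformE (x y : F) : bform x y = Tr (adj x * y).
Proof.
rewrite /bform /adj mulrDl !TrD; congr (_ + _).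
rewrite -[RHS]Tr_frob exprMn -exprM -expnSr prednK //.
by rewrite (frob_card cardF).
Qed.

Lemma bformZ c (x y : F) : c \in Fp -> bform (c * x) y = c * bform x y.
Proof.
move=> cF; rewrite /bform -TrZ // exprMn (Fp_exp p_pr charF cF).
by congr (Tr _); ring.
Qed.

Lemma bformC (x y : F) : bform x y = bform y x.
Proof. by rewrite /bform; congr (Tr _); ring. Qed.

(** The hypothesis says that [l] is a nonzero element of F_(p^2). Then l^(p+1) is its norm, which
    lies in F_p and comes out of the trace. *)
Lemma qform_scale l (x : F) : l ^+ (p ^ 2 - 1) = 1 -> qform (l * x) = l ^+ p.+1 * qform x.
Proof.
move=> l1; rewrite /qform exprMn TrZ // (primeFieldE p_pr charF) -exprM.
have -> : (p.+1 * p = (p ^ 2 - 1) + p.+1)%N by nia.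
by rewrite exprD l1 mul1r.
Qed.

Lemma qformZ c (x : F) : c \in Fp -> qform (c * x) = c ^+ 2 * qform x.
Proof.
move=> cF; rewrite /qform exprMn exprS (Fp_exp p_pr charF cF) -expr2 TrZ //.
by rewrite expr2 (FpM p_pr charF).
Qed.

Lemma adjD (x y : F) : adj (x + y) = adj x + adj y.
Proof. by rewrite /adj frob1D (frobD p_pr charF) addrACA. Qed.

(** Nondegeneracy of B. The p-th power of adj b = 0 reads b^(p^2) = - b; after m iterations b =
    b^(p^e) = (-1)^m b = - b, as m is odd. *)
Lemma adj_eq0 (b : F) : adj b = 0 -> b = 0.
Proof.
move=> b0; have bpp : b ^+ (p ^ 2) = - b.
  apply/eqP; rewrite -addr_eq0.
  have : adj b ^+ p = 0 by rewrite b0 expr0n gtn_eqF // prime_gt0.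
  by rewrite /adj frob1D -!exprM -expnSr prednK // (frob_card cardF) mulnn => ->.
have bk k : b ^+ (p ^ k.*2) = (-1) ^+ k * b.
  elim: k => [|k IH]; first by rewrite expr0 mul1r expr1.
  rewrite doubleS -addn2 expnD exprM IH exprMn bpp -exprM exprS mulN1r mulrN mulNr.
  by rewrite -(signr_odd _ (k * p ^ 2)) oddM oddX p_odd orbT andbT signr_odd.
have := bk m; rewrite (frob_card cardF) -signr_odd m_odd mulN1r => /eqP.
by rewrite -addr_eq0 -mulr2n -mulr_natr mulf_eq0 (negPf two_neq0) orbF => /eqP.
Qed.

Lemma adj_inj : injective adj.
Proof.
move=> x y exy; apply/eqP; rewrite -subr_eq0; apply/eqP/adj_eq0.
by have := adjD (x - y) y; rewrite subrK exy => /eqP; rewrite -subr_eq subrr => /eqP.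
Qed.

Lemma card_bform (b s : F) : b != 0 -> s \in Fp ->
  #|[set y | bform b y == s]| = (p ^ e.-1)%N.
Proof.
move=> b0 sF; rewrite -(card_Trmul_fibre p_pr charF cardF e_gt0 (a := adj b) _ sF).
  by apply: eq_card => y; rewrite !inE bformE.
by apply: contra_neq b0 => /adj_eq0.
Qed.

(** * Value distribution of Q, alone and jointly with a linear form *)

Definition nQ (c : F) : nat := #|[set x | qform x == c]|.

Let p2_dvd : (p ^ 2 - 1 %| #|F|.-1)%N.
Proof.
rewrite cardF -mul2n expnM -[(_ ^ m).-1]subn1 -[X in (_ %| _ - X)%N](exp1n m).
by rewrite subn_exp dvdn_mulr.
Qed.

(** The norm from F_(p^2) to F_p is onto: c = t^(p+1) for some t with t^(p^2-1) = 1, and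
    multiplication by t maps the points where Q is 1 onto those where Q is c. *)
Lemma nQ_const c : c \in Fp -> c != 0 -> nQ c = nQ 1.
Proof.
move=> cF c0; have [g gP] := exists_prim_root F.
have cp : c ^+ p.-1 = 1.
  by apply: (mulfI c0); rewrite -exprS prednK ?prime_gt0 // (Fp_exp p_pr charF) ?mulr1.
have cq : c ^+ #|F|.-1 = 1.
  by apply: (mulfI c0); rewrite -exprS prednK ?expf_card ?mulr1 // cardF expn_gt0 prime_gt0.
have [[j _] /= cE] := prim_rootP gP cq.
have /dvdnP[k kE] := p2_dvd.
have k0 : (0 < k)%N.
  rewrite lt0n; apply: contraTneq (card_finNzRing_gt1 F) => k0.
  by rewrite -subn_gt0 subn1 kE k0.
(* With c = g^j and q - 1 = k (p+1) (p-1), this divisibility makes j a multiple l k (p+1), so t =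
   g^(l k) has norm c. *)
have : (#|F|.-1 %| j * p.-1)%N by rewrite (prim_order_dvd gP) exprM -cE cp.
have -> : #|F|.-1 = (k * p.+1 * p.-1)%N by rewrite kE; nia.
rewrite dvdn_pmul2r; last by lia.
case/dvdnP=> l jE; pose t := g ^+ (l * k).
have t1 : t ^+ (p ^ 2 - 1) = 1.
  by rewrite -exprM -mulnA -kE mulnC exprM (prim_expr_order gP) expr1n.
have tc : t ^+ p.+1 = c by rewrite cE -exprM jE mulnA.
have tN : t != 0 by apply: contra_neq c0 => t0; rewrite -tc t0 exprS mul0r.
rewrite /nQ -[RHS](card_imset _ (mulfI tN)); apply: eq_card => x.
rewrite inE; apply/eqP/imsetP => [xc|[y + ->]].
  exists (t^-1 * x); rewrite ?mulVKf // inE qform_scale; last by rewrite exprVn t1 invr1.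
  by rewrite xc exprVn tc mulVf.
by rewrite inE => /eqP y1; rewrite qform_scale // y1 mulr1.
Qed.

(** The nonzero zeros of Q are stable under the (p^2-1)-th roots of unity, by [qform_scale]. *)
Lemma nQ0_mod : (p ^ 2 - 1 %| (nQ 0%R).-1)%N.
Proof.
have -> : (nQ 0%R).-1 = #|[set x | qform x == 0] :\ (0 : F)|.
  by rewrite /nQ (cardsD1 0) inE /qform expr0n Tr0 ?eqxx.
apply: (dvdn_card_stable p2_dvd) => [|l x l1]; first by rewrite !inE eqxx.
rewrite !inE => /andP[x0 /eqP Qx]; rewrite qform_scale // Qx mulr0 eqxx andbT.
rewrite mulf_neq0 //; apply: contra_eq_neq l1 => ->.
rewrite expr0n gtn_eqF ?subn_gt0 ?ltn_exp2l ?exp1n //=; first by rewrite eq_sym oner_neq0.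
by rewrite -(exp1n 2) ltn_sqr; lia.
Qed.

Lemma qform_Fp x : qform x \in Fp. Proof. exact: (Tr_Fp p_pr charF cardF). Qed.
Lemma bform_Fp x y : bform x y \in Fp. Proof. exact: (Tr_Fp p_pr charF cardF). Qed.

Lemma sum_nQ : (\sum_(c in Fp) nQ c = p ^ e)%N.
Proof.
by rewrite -cardF; apply: sum_card_fibre qform_Fp.
Qed.

(* (u, v) |-> (u + v, u - v) turns Q x = Q y into B u v = 0. *)
Lemma sum_nQ_sq : (\sum_(c in Fp) nQ c ^ 2 = p ^ e + (p ^ e - 1) * p ^ e.-1)%N.
Proof.
transitivity (\sum_(u : F) \sum_(v : F) (qform (u + v)%R == qform (u - v)%R))%N.
  transitivity (\sum_(x : F) \sum_(y : F) (qform x == qform y))%N.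
    transitivity (\sum_x nQ (qform x))%N.
      rewrite [RHS](partition_big qform (mem Fp)) /=; last by move=> x _; exact: qform_Fp.
      apply: eq_bigr => c _; rewrite expnS expn1 {1}/nQ -sum_nat_const.
      by apply: eq_big => [x|x]; rewrite inE // => /eqP ->.
    apply: eq_bigr => x _; rewrite /nQ -sum1dep_card big_mkcond.
    by apply: eq_bigr => y _; rewrite eq_sym; case: eqP.
  rewrite !pair_big /=; pose f (z : F * F) := (z.1 + z.2, z.1 - z.2).
  rewrite (reindex_inj (h := f)) //= => [[a b] [c d]] [] /= h1 h2.
  have ac : a = c.
    apply: (mulfI two_neq0); transitivity ((a + b) + (a - b)); first by ring.
    by rewrite h1 h2; ring.
  by move: h1; rewrite ac => /addrI ->.
have step u : (\sum_(v : F) (qform (u + v)%R == qform (u - v)%R) = #|[set v | bform u v == 0%R]|)%N.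
  rewrite -sum1dep_card [RHS]big_mkcond; apply: eq_bigr => v _; rewrite !qformD.
  have -> : bform u (- v) = - bform u v.
    by rewrite -mulN1r bformC bformZ ?mulN1r 1?bformC ?(FpN p_pr charF) ?Fp1.
  have -> : qform (- v) = qform v.
    by rewrite -mulN1r qformZ ?(FpN p_pr charF) ?Fp1 // sqrrN expr1n mul1r.
  rewrite (inj_eq (addIr _)) (inj_eq (addrI _)) -addr_eq0 -mulr2n -mulr_natr mulf_eq0.
  by rewrite (negPf two_neq0) orbF; case: eqP.
under eq_bigr => u _ do rewrite step.
(* The row u = 0 contains every v; each of the other p^e - 1 rows is an affine hyperplane of p^(e-1)
   points. *)
rewrite (bigD1 0) //=; congr (_ + _)%N.
  rewrite -cardF -cardsT; apply: eq_card => v; rewrite !inE /bform expr0n.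
  by rewrite gtn_eqF ?prime_gt0 // !mul0r addr0 Tr0 ?eqxx.
rewrite subn1 -cardF -(cardC1 (0 : F)) -sum_nat_const; apply: eq_big => [u|u u0].
  by rewrite inE.
by rewrite card_bform // Fp0.
Qed.

Let pE : (p ^ e = p ^ 2 * (p ^ m.-1) ^ 2)%N.
Proof. by rewrite -expnMn -expnS prednK // -expnM muln2. Qed.
Let pE1 : (p ^ e.-1 = p * (p ^ m.-1) ^ 2)%N.
Proof. by rewrite -expnM -expnS; congr expn; lia. Qed.
Let pE2 : (p ^ (e - 2) = (p ^ m.-1) ^ 2)%N.
Proof. by rewrite -expnM; congr expn; lia. Qed.
Let pM : (p ^ m = p * p ^ m.-1)%N.
Proof. by rewrite -expnS prednK. Qed.

Lemma card_Fp_nz : #|[set c in Fp | c != 0]| = p.-1.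
Proof.
rewrite -[in RHS](card_primeField p_pr charF) [in RHS](cardsD1 0) (Fp0 p_pr charF) /=.
by apply: eq_card => x; rewrite !inE andbC.
Qed.

(** By [nQ_const] only the values at 0 and 1 are unknown, and the two moments with [nQ0_mod]
    determine them. The additive form covers c = 0 and c nonzero without a truncated subtraction. *)
Lemma nQE c : c \in Fp -> (nQ c + (c == 0%R) * p ^ m = p ^ e.-1 + p ^ m.-1)%N.
Proof.
have sumf f : (\sum_(c in Fp) f (nQ c) = f (nQ 0%R) + p.-1 * f (nQ 1%R))%N.
  rewrite (bigD1 0) ?Fp0 //=; congr addn.
  rewrite (eq_bigr (fun=> f (nQ 1%R))); last by move=> x /andP[xF x0]; rewrite nQ_const.
  by rewrite sum_nat_cond_const card_Fp_nz.
have E1 := sumf id; rewrite sum_nQ pE in E1.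
have E2 := sumf (fun n => n ^ 2)%N; rewrite sum_nQ_sq pE1 pE in E2.
have n00 : (0 < nQ 0%R)%N.
  by apply/card_gt0P; exists 0; rewrite inE /qform expr0n Tr0.
have s0 : (0 < p ^ m.-1)%N by rewrite expn_gt0 prime_gt0.
(* As m - 1 is even, p^(m-1) is a power of p^2. *)
have smod : (p ^ 2 - 1 %| p ^ m.-1 - 1)%N.
  by apply: even_expn_mod (prime_gt0 p_pr); move: m_odd; rewrite -{1}(prednK m_gt0).
have n1 := two_values_solve p_gt2 n00 s0 smod nQ0_mod (esym E1) (esym E2).
have [->|c0] := eqVneq c 0 => cF; last by rewrite nQ_const // n1 mul0n addn0 pE1.
rewrite pE1 pM mul1n; move: E1; rewrite n1 /=.
have : (p = p.-1.+1)%N by rewrite prednK ?prime_gt0.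
clear; move: p.-1 (p ^ m.-1)%N (nQ 0) => k s n0 ->; rewrite !expnS !expn0; lia.
Qed.

(* For fixed y, the equation Q y + w (B b y - s) = c in w has p, 0 or 1 solutions,
   while for fixed w it reads Q (y + w b) = c + w s + w^2 Q b. *)
Lemma card_qform_bform (b c s : F) : b != 0 -> c \in Fp -> s \in Fp ->
  (#|[set y | (qform y == c) && (bform b y == s)]|
   + #|[set w in Fp | (c + w * s + w ^+ 2 * qform b == 0)%R]| * p ^ m.-1
   = p ^ m.-1 + p ^ (e - 2))%N.
Proof.
move=> b0 cF sF; set N := #|_|; set K := #|_|.
have FpD := FpD p_pr charF; have FpM := FpM p_pr charF; have FpN := FpN p_pr charF.
pose V := (\sum_(y : F) (bform b y != s))%N.
have VE : (V + p ^ e.-1 = p ^ e)%N.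
  rewrite -(card_bform b0 sF) -cardF -sum1dep_card [X in (_ + X)%N]big_mkcond -big_split /=.
  by rewrite -sum1_card; apply: eq_bigr => y _; case: eqP.
have dc : (\sum_(w in Fp) nQ (c + w * s + w ^+ 2 * qform b)%R = p * N + V)%N.
  transitivity (\sum_(w in Fp) \sum_y (qform y + w * (bform b y - s) == c)%R)%N.
    apply: eq_bigr => w wF; rewrite /nQ -sum1dep_card big_mkcond.
    rewrite (reindex_inj (addIr (w * b))) /=; apply: eq_bigr => y _.
    rewrite qformD qformZ // bformC bformZ // -addrA !(addrA _ _ (w ^+ 2 * _)) (inj_eq (addIr _)).
    rewrite -subr_eq.
    have -> : qform y + w * bform b y - w * s = qform y + w * (bform b y - s) by ring.
    by case: eqP.
  rewrite exchange_big /= /N -sum1dep_card [X in (p * X)%N]big_mkcond big_distrr -big_split /=.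
  apply: eq_bigr => y _; have [->|Bs] := eqVneq (bform b y) s.
    under eq_bigr => w _ do rewrite subrr mulr0 addr0.
    by rewrite sum_nat_const (card_primeField p_pr charF) andbT addn0; case: eqP.
  rewrite andbF muln0 add0n.
  pose w0 := (c - qform y) / (bform b y - s).
  have Bs0 : bform b y - s != 0 by rewrite subr_eq0.
  have w0F : w0 \in Fp.
    by rewrite FpM ?(FpV p_pr charF) // FpD ?FpN ?qform_Fp ?bform_Fp.
  rewrite (bigD1 w0) //= big1 => [|w /andP[_ ww0]].
    by rewrite divfK // addrC subrK eqxx.
  rewrite -(inj_eq (addIr (- qform y))) addrAC subrr add0r.
  by rewrite -(inj_eq (mulIf (invr_neq0 Bs0))) mulfK // (negPf ww0).
(* Summing [nQE] over w: its correction p^m occurs once for each of the [K] values of w at which the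
   argument vanishes. *)
have : (\sum_(w in Fp) nQ (c + w * s + w ^+ 2 * qform b)%R + K * p ^ m
        = p * (p ^ e.-1 + p ^ m.-1))%N.
  rewrite -[X in _ = (X * _)%N](card_primeField p_pr charF) -[RHS]sum_nat_const /K -sum1dep_card big_mkcondr.
  rewrite big_distrl -big_split /=; apply: eq_bigr => w wF.
  rewrite -(nQE (c := c + w * s + w ^+ 2 * qform b)); last first.
    by rewrite !FpD ?FpM ?qform_Fp // expr2 FpM.
  by congr addn; case: eqP.
rewrite dc pE2 pM; move: VE; rewrite pE pE1.
have := prime_gt0 p_pr; clear; move: (p ^ m.-1)%N => t p0 VE E.
apply/eqP; rewrite -(eqn_pmul2l p0); apply/eqP; move: E VE; rewrite !expnS !expn0; lia.
Qed.

(** * Completing the square: translation by 1/2 *)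

Lemma bform1 (x : F) : bform 1 x = 2%:R * Tr x.
Proof. by rewrite /bform expr1n !mul1r TrD Tr_frob -mulr2n mulr_natl. Qed.

Lemma half_Fp : 2%:R^-1 \in Fp.
Proof. by rewrite (FpV p_pr charF) // (Fp_nat p_pr charF). Qed.

Lemma bform_half (x : F) : bform 2%:R^-1 x = Tr x.
Proof. by rewrite -[2%:R^-1]mulr1 bformZ ?half_Fp // bform1 mulKf. Qed.

Hypothesis p_dvd_e : (p %| e)%N.

(** Q 1 = Tr 1 is e copies of 1, which vanishes because p divides e. *)
Lemma qform1 : qform 1 = 0.
Proof.
rewrite /qform expr1n /Defs.Tr; under eq_bigr => i _ do rewrite expr1n.
by rewrite sumr_const card_ord; apply/eqP; rewrite -(dvdn_pcharf charF).
Qed.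

Lemma qform_half : qform 2%:R^-1 = 0.
Proof. by rewrite -[2%:R^-1]mulr1 qformZ ?half_Fp // qform1 mulr0. Qed.

(** Since Tr x = B (1/2) x and Q (1/2) = 0, expanding Q (x + 1/2) gives Q x + Tr x, and the linear
    term cancels. *)
Lemma Tr_shift (x : F) : Tr ((x + 2%:R^-1) ^+ p.+1 - (x + 2%:R^-1)) = qform x.
Proof.
rewrite TrB -/(qform _) qformD qform_half addr0 bformC bform_half TrD.
suff -> : Tr 2%:R^-1 = 0 by rewrite addr0 addrK.
(* Symmetry of B gives 2 Tr (1/2) = B 1 (1/2) = B (1/2) 1 = Tr 1 = 0. *)
apply: (mulfI two_neq0); rewrite mulr0 -bform1 bformC bform_half.
by move: qform1; rewrite /qform expr1n.
Qed.

Lemma card_qform_in (A : {set F}) (P : pred F) :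
  #|[set y | (qform y \in A) && P y]| = (\sum_(c in A) #|[set y | (qform y == c) && P y]|)%N.
Proof.
rewrite -sum1dep_card (partition_big qform (mem A)) /=; last by move=> y /andP[].
apply: eq_bigr => c cA; rewrite sum1dep_card; apply: eq_card => y; rewrite !inE.
by case: eqP => [->|_]; rewrite ?cA ?andbT ?andbF.
Qed.

(** * The code of a class [A] with the properties shared by squares and non-squares *)

Section Code.

Variable A : {set F}.
Hypotheses (A_Fp : {subset A <= Fp}) (A_nz : 0 \notin A) (cardA : #|A| = p./2).
Hypothesis A_sq : forall w x, w \in Fp -> w != 0 -> (w ^+ 2 * x \in A) = (x \in A).

(** By [Tr_shift], the translate by 1/2 of the set where Q takes values in [A]. *)
Definition Dshift : {set F} := [set x | Tr (x ^+ p.+1 - x) \in A].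

Lemma card_Dshift_in (P : pred F) :
  #|[set x in Dshift | P x]| = #|[set y | (qform y \in A) && P (y + 2%:R^-1)]|.
Proof.
rewrite -[RHS](card_imset _ (addIr (2%:R^-1 : F))).
apply: eq_card => x; rewrite !inE; apply/andP/imsetP => [[xD Px]|[y]].
  exists (x - 2%:R^-1); rewrite ?subrK // inE subrK Px andbT.
  by rewrite -Tr_shift subrK.
by rewrite inE => /andP[yA Py] ->; rewrite Tr_shift.
Qed.

Lemma card_Dshift : #|Dshift| = (p./2 * (p ^ e.-1 + p ^ m.-1))%N.
Proof.
have -> : #|Dshift| = #|[set x in Dshift | predT x]|.
  by apply: eq_card => x; rewrite !inE andbT.
rewrite card_Dshift_in card_qform_in -cardA -sum_nat_const; apply: eq_bigr => c cA.
rewrite -(nQE (A_Fp cA)) (negPf (_ : c != 0)) ?mul0n ?addn0.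
  by apply: eq_card => y; rewrite !inE andbT.
by apply: contraNneq A_nz => <-.
Qed.

Definition Kcount (u v : F) : nat := #|[set w in Fp | w * u - w ^+ 2 * v \in A]|.

(** For u = 0 and w nonzero, membership depends only on - v, because [A] is stable under nonzero
    squares. For u nonzero, the substitution w = u / (z + v) gives w u - w^2 v = w^2 z, so the
    solutions correspond to the z in [A] other than - v. *)
Lemma KcountE (u v : F) : u \in Fp -> v \in Fp ->
  Kcount u v = (if u == 0%R then (- v \in A)%R * p.-1 else p./2 - (- v \in A)%R)%N.
Proof.
move=> uF vF; have [->|u0] := eqVneq u 0.
  rewrite -card_Fp_nz /Kcount; have [vA|vA] := boolP (- v \in A).
    rewrite mul1n; apply: eq_card => w; rewrite !inE mulr0 add0r -mulrN.
    have [wF|//] := boolP (w \in Fp); have [->|w0] := eqVneq w 0; last by rewrite A_sq.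
    by rewrite expr0n mul0r (negPf A_nz).
  rewrite mul0n; apply: eq_card0 => w; rewrite !inE mulr0 add0r -mulrN.
  have [wF|//] := boolP (w \in Fp); have [->|w0] := eqVneq w 0.
    by rewrite expr0n mul0r (negPf A_nz).
  by rewrite A_sq // (negPf vA).
have -> : (p./2 - (- v \in A)%R)%N = #|A :\ - v| by rewrite -cardA (cardsD1 (- v) A) addKn.
rewrite -[RHS](card_in_imset (f := fun z => u / (z + v))); last first.
  move=> x y _ _ /= /(mulfI u0)/invr_inj/addIr //.
apply: eq_card => w; rewrite !inE; apply/andP/imsetP => [[wF wA]|[z]].
  have w0 : w != 0 by apply: contraTneq wA => ->; rewrite mul0r expr0n mul0r subr0.
  exists (u / w - v); last by rewrite subrK invf_div mulrC divfK.
  rewrite !inE -subr_eq0 opprK subrK mulf_neq0 ?invr_eq0 //=.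
  rewrite -(A_sq _ wF w0); suff -> : w ^+ 2 * (u / w - v) = w * u - w ^+ 2 * v by [].
  by field.
rewrite !inE => /andP[zv zA] ->; have zv0 : z + v != 0 by rewrite addr_eq0.
have zvF : z + v \in Fp by rewrite (FpD p_pr charF) // A_Fp.
have wF : u / (z + v) \in Fp by rewrite (FpM p_pr charF) ?(FpV p_pr charF).
have w0 : u / (z + v) != 0 by rewrite mulf_neq0 ?invr_eq0.
split=> //; rewrite -(A_sq z wF w0) in zA.
suff -> : u / (z + v) * u - (u / (z + v)) ^+ 2 * v = (u / (z + v)) ^+ 2 * z by [].
by field.
Qed.

(** The weight is the length minus the number of zeros in D. After the translation by 1/2 a zero
    satisfies B b y = - Tr b, so [card_qform_bform] is summed over c in [A] with s = - Tr b. *)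
Lemma wt_adj (b : F) : b != 0 ->
  wt (codeword p e Dshift (adj b))
  = (p./2 * p.-1 * p ^ (e - 2) + Kcount (Tr b) (qform b) * p ^ m.-1)%N.
Proof.
move=> b0; set K := Kcount _ _.
have sF : - Tr b \in Fp by rewrite (FpN p_pr charF) // (Tr_Fp p_pr charF cardF).
have split_D : (wt (codeword p e Dshift (adj b))
               + #|[set x in Dshift | bform b x == 0%R]| = #|Dshift|)%N.
  rewrite -(cardsID [set x | bform b x == 0] Dshift) addnC; congr addn.
    by apply: eq_card => x; rewrite !inE.
  apply: eq_card => x; rewrite !inE ffunE inE.
  by case: ifP => _; rewrite ?andbT ?andbF ?eqxx // bformE.
have zeros : (#|[set x in Dshift | bform b x == 0%R]| + K * p ^ m.-1
             = p./2 * (p ^ m.-1 + p ^ (e - 2)))%N.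
  rewrite (card_Dshift_in (fun x => bform b x == 0)).
  rewrite (card_qform_in A (fun y => bform b (y + 2%:R^-1) == 0)).
  (* Each w solves the equation for exactly one c, namely w Tr b - w^2 Q b, and is counted when this
     c lies in [A]. *)
  have -> : K = (\sum_(c in A) #|[set w in Fp | (c + w * - Tr b + w ^+ 2 * qform b == 0)%R]|)%N.
    rewrite /K /Kcount -sum1dep_card.
    rewrite (partition_big (fun w => w * Tr b - w ^+ 2 * qform b) (mem A)) /=; last first.
      by move=> w /andP[].
    apply: eq_bigr => c cA; rewrite sum1dep_card; apply: eq_card => w; rewrite !inE.
    rewrite -andbA; congr andb.
    have -> : c + w * - Tr b + w ^+ 2 * qform b = c - (w * Tr b - w ^+ 2 * qform b) by ring.
    by rewrite subr_eq0 [c == _]eq_sym; case: eqP => [->|]; rewrite ?cA ?andbT ?andbF.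
  rewrite big_distrl -big_split -cardA -sum_nat_const /=; apply: eq_bigr => c cA.
  rewrite -(card_qform_bform b0 (A_Fp cA) sF); congr addn; apply: eq_card => y; rewrite !inE.
  congr andb; rewrite bformE mulrDr TrD -!bformE [bform b 2%:R^-1]bformC bform_half.
  by rewrite addr_eq0.
move: split_D zeros; rewrite card_Dshift pE1 pE2.
have : p = p.-1.+1 by rewrite prednK ?prime_gt0.
clear; move: (p ^ m.-1)%N (wt _) #|_| p./2 p.-1 => s W0 Z h k -> /=.
rewrite !expnS expn0; lia.
Qed.

(** This is [card_qform_bform] at the vector 1/2. As Q (1/2) = 0, the equation in w is linear, c + w
    u = 0 with c nonzero: it has no root for u = 0 and exactly one otherwise. *)
Lemma card_neg_qform_Tr (u : F) : u \in Fp ->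
  #|[set b | (Tr b == u) && (- qform b \in A)]|
  = (p./2 * (p ^ (e - 2) + (u == 0%R) * p ^ m.-1))%N.
Proof.
(* The condition concerns - Q b, and [A] is not assumed symmetric, so its negative takes its
   place. *)
move=> uF; pose A' := [set - c | c in A].
have A'E c : (c \in A') = (- c \in A) by rewrite -[in LHS](opprK c) mem_imset //; exact: oppr_inj.
have A'Fp c : c \in A' -> c \in Fp.
  by rewrite A'E => /A_Fp/(FpN p_pr charF); rewrite opprK.
transitivity #|[set y | (qform y \in A') && (Tr y == u)]|.
  by apply: eq_card => b; rewrite !inE A'E andbC.
rewrite (card_qform_in _ (fun y => Tr y == u)) -cardA -(card_imset A oppr_inj) -sum_nat_const.
apply: eq_bigr => c cA'.
have cF : c \in Fp by exact: A'Fp.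
have := card_qform_bform (invr_neq0 two_neq0) cF uF; rewrite qform_half.
have -> : #|[set y | (qform y == c) && (bform 2%:R^-1 y == u)]|
          = #|[set y | (qform y == c) && (Tr y == u)]|.
  by apply: eq_card => y; rewrite !inE bform_half.
have [u0|u0] := eqVneq u 0.
  rewrite (_ : [set w in Fp | _] = set0) ?cards0 ?addn0 ?mul1n => [->|]; first by rewrite addnC.
  apply/setP => w; rewrite !inE u0 !mulr0 !addr0; apply/negbTE/nandP; right.
  by apply: contraNneq A_nz => c0; move: cA'; rewrite A'E c0 oppr0.
rewrite (_ : [set w in Fp | _] = [set - c / u]) ?cards1.
  by rewrite mul1n mul0n addn0 addnC => /addnI.
apply/setP => w; rewrite !inE mulr0 addr0 addrC addr_eq0.
rewrite -[w * u == _](inj_eq (mulIf (invr_neq0 u0))) mulfK //.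
case: eqP => [->|]; rewrite ?andbF // andbT.
by rewrite (FpM p_pr charF) ?(FpV p_pr charF) ?(FpN p_pr charF).
Qed.

Lemma card_neg_qform : #|[set b | - qform b \in A]| = (p./2 * (p ^ e.-1 + p ^ m.-1))%N.
Proof.
transitivity (\sum_(u in Fp) #|[set b | (Tr b == u) && (- qform b \in A)]|)%N.
  rewrite -sum1dep_card (partition_big Tr (mem Fp)) /=; last first.
    by move=> b _; exact: (Tr_Fp p_pr charF cardF).
  by apply: eq_bigr => u _; rewrite sum1dep_card; apply: eq_card => b; rewrite !inE andbC.
rewrite (eq_bigr _ card_neg_qform_Tr) -big_distrr /= big_split /= sum_nat_const.
rewrite (card_primeField p_pr charF) pE1 pE2 -big_distrl /= (bigD1 0) ?Fp0 //= eqxx big1 ?mul1n //.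
by move=> u /andP[_ /negPf->].
Qed.

Local Notation cw b := (codeword p e Dshift (adj b)).

(** The arguments are the truth values of Tr b = 0 and of - Q b in [A]; together they fix the weight
    of a nonzero b. *)
Definition weight (tz qA : bool) : nat :=
  (p./2 * p.-1 * p ^ (e - 2) + (if tz then qA * p.-1 else p./2 - qA) * p ^ m.-1)%N.

Definition freq (tz qA : bool) : nat :=
  #|[set b | ((Tr b == 0) == tz) && ((- qform b \in A) == qA)]|.

Lemma wt_cw (b : F) : b != 0 -> wt (cw b) = weight (Tr b == 0) (- qform b \in A).
Proof.
move=> b0; rewrite wt_adj // KcountE // ?qform_Fp //.
exact: (Tr_Fp p_pr charF cardF).
Qed.

Lemma wt_cw0 : wt (cw 0) = 0%N.
Proof.
apply: eq_card0 => x; rewrite !inE ffunE /adj !expr0n !gtn_eqF ?expn_gt0 ?prime_gt0 //.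
by rewrite addr0 mul0r Tr0 // if_same eqxx.
Qed.

Lemma weight_gt0 tz qA : (0 < weight tz qA)%N.
Proof.
by rewrite addn_gt0 !muln_gt0 expn_gt0 (prime_gt0 p_pr) half_gt0 -subn1 subn_gt0 (prime_gt1 p_pr).
Qed.

(** The encoding is additive and every nonzero b has positive weight, so its kernel is trivial. *)
Lemma cw_inj : injective (fun b => cw b).
Proof.
move=> b b' /ffunP eqw; apply/eqP; rewrite -subr_eq0; apply: contraT => d0.
have := weight_gt0 (Tr (b - b') == 0) (- qform (b - b') \in A).
rewrite -wt_cw // => /card_gt0P[x]; rewrite inE ffunE.
have := eqw x; rewrite !ffunE; case: ifP => _ E; last by rewrite eqxx.
have := adjD (b - b') b'; rewrite subrK => adjE.
by move: E; rewrite adjE mulrDl TrD => /eqP; rewrite -[X in _ == X]add0r (inj_eq (addIr _)) => ->.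
Qed.

(** An injective map of a finite set to itself is onto, so [adj b] runs over all multipliers. *)
Lemma Dcode_imset : Dcode p e Dshift = [set cw b | b : F].
Proof.
apply/setP => c; apply/imsetP/imsetP => [[a _ ->]|[b _ ->]]; last by exists (adj b).
by have /codomP[b ->] := injF_onto adj_inj a; exists b.
Qed.

Lemma card_Dcode : #|Dcode p e Dshift| = (p ^ e)%N.
Proof. by rewrite Dcode_imset (card_imset _ cw_inj) cardF. Qed.

Lemma qform0 : qform 0 = 0.
Proof. by rewrite /qform expr0n Tr0. Qed.

(** The nonzero b are grouped by type. The vector 0 has type (true, false), hence the predecessor
    there. A sum of indicators is used because weights can coincide: for p = 3 the types (true,
    false) and (false, true) have the same weight. *)
Lemma AcountE w : Acount (Dcode p e Dshift) w =
  ((w == 0%N) + ((weight true false == w) * (freq true false).-1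
   + (weight true true == w) * freq true true + (weight false false == w) * freq false false
   + (weight false true == w) * freq false true))%N.
Proof.
have -> : Acount (Dcode p e Dshift) w = #|[set b | wt (cw b) == w]|.
  rewrite -(card_imset _ cw_inj); apply: eq_card => c; rewrite inE Dcode_imset.
  apply/andP/imsetP => [[/imsetP[b _ ->]]|[b]]; first by exists b; rewrite ?inE.
  by rewrite inE => wb ->; split=> //; apply/imsetP; exists b.
rewrite -sum1dep_card big_mkcond (bigD1 0) //= wt_cw0; congr addn; first by rewrite [w == _]eq_sym; case: eqP.
pose t (b : F) := (Tr b == 0, - qform b \in A).
rewrite (partition_big t predT) //=.
transitivity (\sum_(j : bool * bool) (weight j.1 j.2 == w)
    * #|[set b | (b != 0%R) && (t b == j)]|)%N.
  apply: eq_bigr => j _; rewrite -sum1dep_card big_distrr /=; apply: eq_bigr => b.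
  by case/andP=> b0 /eqP <-; rewrite wt_cw //= muln1; case: eqP.
(* Outside the type (true, false), the condition that b be nonzero is automatic. *)
have fE x y : ~~ (x && ~~ y) -> #|[set b | (b != 0%R) && (t b == (x, y))]| = freq x y.
  move=> xy; apply: eq_card => b; rewrite !inE -pair_eqE /=.
  have [->|//] := eqVneq b 0; rewrite Tr0 // qform0 oppr0 eqxx (negPf A_nz).
  by case: x xy; case: y.
have -> : (freq true false).-1 = #|[set b | (b != 0%R) && (t b == (true, false))]|.
  rewrite /freq [in LHS](cardsD1 0) [0 \in _]inE Tr0 // qform0 oppr0 eqxx (negPf A_nz) /=; apply: eq_card => b.
  by rewrite !inE -pair_eqE.
rewrite -(pair_bigA _ (fun x y => (weight x y == w) * #|[set b | (b != 0%R) && (t b == (x, y))]|)%N).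
rewrite /= !big_bool /= (fE true true) // (fE false true) // (fE false false) //.
by rewrite addnA [X in (X + _ + _)%N]addnC addnAC.
Qed.

(** One entry, two marginals and the total, in the form that [freq_solve] takes as input. *)
Lemma freqE :
  [/\ freq true true = (p./2 * (p ^ (e - 2) + p ^ m.-1))%N,
      (freq true false + freq true true = p ^ e.-1)%N,
      (freq false true + freq true true = p./2 * (p ^ e.-1 + p ^ m.-1))%N
    & (freq true true + freq true false + (freq false true + freq false false) = p ^ e)%N].
Proof.
have split_card (P P' : pred F) :
    (#|[set b | P b && (P' b == true)]| + #|[set b | P b && (P' b == false)]| = #|[set b | P b]|)%N.
  rewrite -(cardsID [set b | P' b] [set b | P b]); congr addn; apply: eq_card => b.
    by rewrite !inE eqb_id.
  by rewrite !inE eqbF_neg andbC.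
split.
- have := card_neg_qform_Tr (Fp0 p_pr charF); rewrite eqxx mul1n => <-.
  by apply: eq_card => b; rewrite !inE !eqb_id.
- rewrite addnC /freq (split_card (fun b => (Tr b == 0) == true) (fun b => - qform b \in A)).
  rewrite -(card_Tr_fibre p_pr charF cardF e_gt0 (Fp0 p_pr charF)).
  by apply: eq_card => b; rewrite !inE eqb_id.
- rewrite -card_neg_qform addnC -(split_card _ (fun b => Tr b == 0)).
  by congr addn; apply: eq_card => b; rewrite !inE andbC; case: (_ \in A).
rewrite -cardF -cardsT -(split_card predT (fun b => Tr b == 0)).
by congr addn; rewrite /freq (split_card _ (fun b => - qform b \in A));
   apply: eq_card => b; rewrite !inE.
Qed.

Lemma nzWeights_sub : {subset nzWeights (Dcode p e Dshift) <=
  [:: weight true false; weight true true; weight false false; weight false true]}.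
Proof.
move=> w; rewrite mem_undup => /mapP[c]; rewrite mem_filter mem_enum Dcode_imset.
case/andP=> c0 /imsetP[b _ cE] ->; rewrite cE wt_cw.
  by rewrite !inE; case: (Tr b == 0); case: (- _ \in A); rewrite eqxx ?orbT.
apply: contraNneq c0 => b0; apply/eqP/ffunP => x; apply/eqP; rewrite ffunE.
have := wt_cw0; rewrite -b0 -cE => /eqP; rewrite cards_eq0 => /eqP/setP/(_ x).
by rewrite !inE b0 => /negbFE.
Qed.

End Code.

(** * The classes of squares and non-squares in the prime field *)

Definition sqFp (x : F) : bool := [exists z in Fp, z ^+ 2 == x].

Lemma sqFp_mul w x : w \in Fp -> w != 0 -> sqFp (w ^+ 2 * x) = sqFp x.
Proof.
move=> wF w0; have w20 : w ^+ 2 != 0 by rewrite expf_neq0.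
apply/exists_inP/exists_inP => [] [z zF /eqP zE].
  exists (z / w); first by rewrite (FpM p_pr charF) ?(FpV p_pr charF).
  by rewrite exprMn exprVn zE mulrAC divff ?mul1r.
by exists (w * z); rewrite ?(FpM p_pr charF) // exprMn zE.
Qed.

Lemma Fp_mul_sq w x : w \in Fp -> w != 0 -> (w ^+ 2 * x \in Fp) = (x \in Fp).
Proof.
move=> wF w0; have w2F : w ^+ 2 \in Fp by rewrite expr2 (FpM p_pr charF).
apply/idP/idP => xF; last by rewrite (FpM p_pr charF).
by rewrite -[x](mulKf (expf_neq0 2 w0)) (FpM p_pr charF) ?(FpV p_pr charF).
Qed.

Lemma Cc_sq i w x : w \in Fp -> w != 0 -> (w ^+ 2 * x \in Cc F p i) = (x \in Cc F p i).
Proof.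
move=> wF w0; case: i; rewrite !inE Fp_mul_sq // mulf_eq0 expf_eq0 (negPf w0) /=;
by rewrite -!/(sqFp _) sqFp_mul.
Qed.

Lemma Cc_Fp i : {subset Cc F p i <= Fp}.
Proof. by case: i => x; rewrite inE => /andP[]. Qed.

Lemma Cc_nz i : 0 \notin Cc F p i.
Proof. by case: i; rewrite !inE eqxx andbF. Qed.

(** Squaring is two-to-one from the nonzero elements of F_p onto the squares, with fibres {z, -
    z}. *)
Lemma card_C0 : #|C0 F p| = p./2.
Proof.
suff : (#|C0 F p| * 2 = p.-1)%N.
  by have := prime_gt0 p_pr; clear; lia.
rewrite -card_Fp_nz -sum_nat_const -sum1dep_card.
rewrite [RHS](partition_big (fun z => z ^+ 2) (mem (C0 F p))) /=; last first.
  move=> z /andP[zF z0]; rewrite !inE -{1}[z ^+ 2]mulr1 Fp_mul_sq // (Fp1 p_pr charF) expf_neq0 //=.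
  by apply/exists_inP; exists z.
apply: eq_bigr => x; rewrite !inE => /and3P[_ x0 /exists_inP[z zF /eqP zE]].
have z0 : z != 0 by apply: contra_neq x0 => z0; rewrite -zE z0 expr0n.
rewrite sum1dep_card (_ : [set _ | _] = [set z; - z]) ?cards2.
  by rewrite -addr_eq0 -mulr2n -mulr_natr mulf_eq0 (negPf two_neq0) orbF z0.
apply/setP => y; rewrite !inE -zE eqf_sqr andbC.
have [->|yz] := eqVneq y z; first by rewrite zF z0.
have [->|yz'] := eqVneq y (- z); first by rewrite (FpN p_pr charF) // oppr_eq0 z0.
by [].
Qed.

Lemma card_Cc i : #|Cc F p i| = p./2.
Proof.
case: i; last exact: card_C0.
have : (#|C0 F p| + #|C1 F p| = p.-1)%N.
  rewrite -card_Fp_nz -(cardsID [set x | sqFp x] [set c in Fp | c != 0]); congr addn; apply: eq_card => x.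
    by rewrite !inE -/(sqFp _) !andbA.
  by rewrite !inE -/(sqFp _) [RHS]andbC andbA.
by rewrite card_C0 /=; move: p_odd; clear; lia.
Qed.

End QuadraticForm.

(* Assembly of length, dimension and weight distribution *)
Local Close Scope ring_scope.

Theorem theorem4 (p e : nat) (F : finFieldType) (i : bool) :
  prime p -> odd p -> e %% 4 = 2 -> p %| e ->
  p \in [pchar F]%R -> #|F| = p ^ e ->
  let C := Dcode p e (@Dset F p e i) in
  [/\ #|@Dset F p e i| = ((p - 1)./2 * p ^ (e - 1) + (p - 1)./2 * p ^ (e./2 - 1))%N,
      codeDim p C = e,
      size (nzWeights C) <= 4
    & forall w : nat,
        Acount C w = \sum_(pr <- wdist p e | pr.1 == w) pr.2]%N.
Proof.
move=> p_pr p_odd e4 pe charF cardF /=.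
set m := e./2.
have eE : e = m.*2 by rewrite /m; lia.
have m_odd : odd m by rewrite /m; lia.
clearbody m; rewrite eE in pe cardF *; clear eE e4.
set D := Dset _ _ _ _.
have A_Fp := @Cc_Fp F p i; have A_nz := Cc_nz F p i.
have cardA := card_Cc p_pr p_odd charF i.
have A_sq := fun w x => @Cc_sq F p p_pr charF i w x.
(* From here on only the four properties of the class matter, so both values of [i] are treated at
   once. *)
have -> : D = Dshift p m (Cc F p i) by apply/setP.
move: (Cc F p i) A_Fp A_nz cardA A_sq => A A_Fp A_nz cardA A_sq; clear D.
have hE : p = p./2.*2.+1 by rewrite -[LHS]odd_double_half p_odd.
have m_gt0 : 0 < m by exact: odd_gt0.
have PE : p ^ (m.*2 - 1) = p * p ^ (m.*2 - 2) by rewrite -expnS; congr expn; lia.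
have PE2 : p ^ m.*2 = p * (p * p ^ (m.*2 - 2)) by rewrite -!expnS; congr expn; lia.
have hp : (p - 1)./2 = p./2 by rewrite {1}hE halfB1.
split.
- by rewrite (card_Dshift p_pr p_odd m_odd charF cardF pe A_Fp A_nz cardA) mulnDr hp -!subn1.
- by rewrite /codeDim (card_Dcode p_pr p_odd m_odd charF cardF pe A_Fp A_nz cardA A_sq) pfactorK.
- have sub := nzWeights_sub p_pr p_odd m_odd charF cardF pe A_Fp A_nz cardA A_sq.
  exact: (uniq_leq_size (undup_uniq _) sub).
move=> w; rewrite (AcountE p_pr p_odd m_odd charF cardF pe A_Fp A_nz cardA A_sq).
(* Turns the table into a sum of indicators, the shape of [AcountE]; equal weights are then added up
   on both sides. *)
have -> : \sum_(pr <- wdist p m.*2 | pr.1 == w) pr.2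
          = \sum_(pr <- wdist p m.*2) (pr.1 == w) * pr.2.
  by rewrite big_mkcond; apply: eq_bigr => pr _; case: eqP; rewrite ?mul1n ?mul0n.
have [TT TF FT FF] := freqE p_pr p_odd m_odd charF cardF pe A_Fp A_nz cardA.
rewrite -subn1 PE PE2 in TF FT FF.
move: (freq p m A) TT TF FT FF => fr TT TF FT FF.
have [TFE FTE FFE] : [/\ (fr true false).-1 = p./2.+1 * p ^ (m.*2 - 2) - 1 - p./2 * p ^ m.-1,
    fr false true = p./2 * p.-1 * p ^ (m.*2 - 2) & fr false false = p./2 * p.+1 * p ^ (m.*2 - 2)].
  move: TT TF FT FF hE; clear; move: (p ^ (m.*2 - 2)) (p ^ m.-1) p./2 => P s h TT TF FT FF pE.
  by rewrite pE in TF FT FF *; exact: freq_solve TF FT FF.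
rewrite TFE TT FTE FFE /wdist !big_cons big_nil /= doubleK /weight.
have -> : (p + 1)./2 = p./2.+1 by rewrite {1}hE halfD1.
have -> : (p - 3)./2 = p./2 - 1 by rewrite {1}hE halfB3.
have -> : ((p - 1) ^ 2)./2 = p./2 * p.-1 by rewrite {1 3}hE half_predn_sqr.
have -> : (p ^ 2 - 1)./2 = p./2 * p.+1 by rewrite {1 3}hE half_sqr_predn.
rewrite hp !subn1 !mul0n !mul1n subn0 !addn0 muln1 [0 == w]eq_sym mulnDr; congr addn.
by rewrite -!addnA; congr addn; rewrite addnCA.
Qed.
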